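(* Let $T\in M^{m\times n}(\mathbb{C})$ and let $T=U_1-V_1=U_2-V_2$ be two proper splittings of $T$ such that $0\leq T^\dagger V_1\leq T^\dagger V_2$ and $\mathcal{N}(V_1)=\mathcal{N}(V_2)$. Then $\rho(U_1^\dagger V_1)\leq\rho(U_2^\dagger V_2)<1$.
   Context: $M^{m\times n}(\mathbb{C})$ denotes the complex $m\times n$ matrices; $\leq$ is the Löwner order: for Hermitian $A,B\in M^{n\times n}(\mathbb{C})$, $A\le B$ iff $B-A$ is positive semidefinite. $A^\dagger$ is the Moore-Penrose inverse, and $\mathcal{R}(\cdot)$, $\mathcal{N}(\cdot)$, $\rho(\cdot)$ denote range, nullspace and spectral radius. Proper splitting: a decomposition $T=U-V$ with $U,V\in M^{m\times n}(\mathbb{C})$ is a proper splitting of $T\in M^{m\times n}(\mathbb{C})$ if $\mathcal{R}(U)=\mathcal{R}(T)$ and $\mathcal{N}(U)=\mathcal{N}(T)$. *)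

(* Defs.v *)
From HB Require Import structures.
From mathcomp Require Export all_boot all_order all_algebra.
From mathcomp Require Export boolp classical_sets reals complex.

Set Implicit Arguments.
Unset Strict Implicit.
Unset Printing Implicit Defensive.

Import Order.TTheory GRing.Theory Num.Theory.
Local Open Scope ring_scope.
Local Open Scope classical_set_scope.
Local Open Scope sesquilinear_scope.

(* Ranges and nullspaces are sets of column vectors: A acts by x |-> A x.
   (MathComp's row spaces and [kermx] refer to the action x |-> x A instead.) *)
Definition range_mx (F : pzRingType) m n (A : 'M[F]_(m, n)) : set 'cV[F]_m :=
  [set A *m x | x in [set: 'cV[F]_n]].

Definition null_mx (F : pzRingType) m n (A : 'M[F]_(m, n)) : set 'cV[F]_n :=
  [set x : 'cV[F]_n | A *m x = 0].

Definition proper_splitting (F : pzRingType) m n (T U V : 'M[F]_(m, n)) : Prop :=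
  [/\ T = U - V, range_mx U = range_mx T & null_mx U = null_mx T].

Section NumClosed.
Variable C : numClosedFieldType.

Definition penrose m n (A : 'M[C]_(m, n)) (X : 'M[C]_(n, m)) : Prop :=
  [/\ A *m X *m A = A, X *m A *m X = X,
      (A *m X)^t* = A *m X & (X *m A)^t* = X *m A].

(* The default value 0 is never used, see [mpinvmxP]. *)
Definition mpinvmx m n (A : 'M[C]_(m, n)) : 'M[C]_(n, m) :=
  xget 0 [set X | penrose A X].

(* In a [numClosedFieldType], 0 <= z means that z is real and nonnegative. *)
Definition psdmx n (A : 'M[C]_n) : Prop :=
  A \is hermsymmx /\ forall x : 'cV[C]_n, 0 <= (x^t* *m A *m x) 0 0.

Definition lowner_le n (A B : 'M[C]_n) : Prop :=
  [/\ A \is hermsymmx, B \is hermsymmx & psdmx (B - A)].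

Lemma trmxC_mul m n p (A : 'M[C]_(m, n)) (B : 'M[C]_(n, p)) :
  (A *m B)^t* = B^t* *m A^t*.
Proof. by rewrite trmx_mul map_mxM. Qed.

Lemma gram_unit {m n} {M : 'M[C]_(m, n)} : row_free M -> M *m M^t* \in unitmx.
Proof.
move=> Mfree; rewrite -row_free_unit; apply/inj_row_free => v /= vMM0.
have vM0 : v *m M = 0.
  have : (v *m M) *m (v *m M)^t* = 0.
    by rewrite trmxC_mul mulmxA -(mulmxA v) vMM0 mul0mx.
  move=> /matrixP/(_ 0 0); rewrite !mxE => /eqP.
  rewrite psumr_eq0 => [/allP s0|i _]; last by rewrite !mxE mul_conjC_ge0.
  apply/rowP => j; have := s0 j (mem_index_enum j).
  by rewrite /= !mxE mul_conjC_eq0 => /eqP.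
by apply/eqP; rewrite -(mulmx_free_eq0 v Mfree) vM0.
Qed.

Lemma penrose_full m n r (F : 'M[C]_(m, r)) (G : 'M[C]_(r, n)) :
  row_free (F^t*) -> row_free G -> exists X, penrose (F *m G) X.
Proof.
move=> /gram_unit; rewrite trmxCK => F_u /gram_unit G_u.
set K := invmx (G *m G^t*); set L := invmx (F^t* *m F).
have KE : G *m G^t* *m K = 1%:M by rewrite mulmxV.
have LE : L *m (F^t* *m F) = 1%:M by rewrite mulVmx.
have Kh : K^t* = K by rewrite /K trmx_inv map_invmx trmxC_mul trmxCK.
have Lh : L^t* = L by rewrite /L trmx_inv map_invmx trmxC_mul trmxCK.
exists (G^t* *m K *m L *m F^t*).
have AX : F *m G *m (G^t* *m K *m L *m F^t*) = F *m L *m F^t*.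
  transitivity (F *m (G *m G^t* *m K) *m L *m F^t*); first by rewrite !mulmxA.
  by rewrite KE mulmx1.
have XA : G^t* *m K *m L *m F^t* *m (F *m G) = G^t* *m K *m G.
  transitivity (G^t* *m K *m (L *m (F^t* *m F)) *m G); first by rewrite !mulmxA.
  by rewrite LE mulmx1.
split; rewrite ?AX ?XA.
- transitivity (F *m (L *m (F^t* *m F)) *m G); first by rewrite !mulmxA.
  by rewrite LE mulmx1.
- transitivity (G^t* *m K *m (G *m G^t* *m K) *m L *m F^t*).
    by rewrite !mulmxA.
  by rewrite KE mulmx1.
- by rewrite !trmxC_mul trmxCK Lh mulmxA.
- by rewrite !trmxC_mul trmxCK Kh mulmxA.
Qed.

Lemma penrose_ex m n (A : 'M[C]_(m, n)) : exists X, penrose A X.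
Proof.
rewrite -(mulmx_base A); apply: penrose_full (row_base_free A).
by rewrite /row_free mxrank_map mxrank_tr; exact: col_base_full.
Qed.

Lemma mpinvmxP m n (A : 'M[C]_(m, n)) : penrose A (mpinvmx A).
Proof. by have [X AX] := penrose_ex A; rewrite /mpinvmx; case: xgetP => // /(_ X). Qed.

Lemma penrose_uniq m n (A : 'M[C]_(m, n)) X Y :
  penrose A X -> penrose A Y -> X = Y.
Proof.
move=> [x1 x2 x3 x4] [y1 y2 y3 y4].
have XY : X *m A = Y *m A.
  rewrite -x4 -{1}y1 !mulmxA -(mulmxA (X *m A)) trmxC_mul x4 y4.
  by rewrite -!mulmxA (mulmxA A) x1.
have YX : A *m X = A *m Y.
  rewrite -x3 -{1}y1 -!mulmxA (mulmxA A) trmxC_mul x3 y3.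
  by rewrite !mulmxA x1.
by rewrite -x2 XY -mulmxA YX mulmxA.
Qed.

End NumClosed.

(* [eigenvalue] refers to row eigenvectors, which does not affect the spectrum.
   For n = 0 the set is empty and its [sup] is 0. *)
Definition spectral_radius (R : realType) n (A : 'M[R[i]]_n) : R :=
  sup [set complex.Re `|z| | z in [set z : R[i] | eigenvalue A z]].

(* Main.v *)
(* For a proper splitting T = U - V put A = T^+ V, with ^+ the Moore-Penrose
   inverse. The equalities of ranges and nullspaces make the projectors UU^+
   and TT^+, and U^+U and T^+T, agree, whence (1 + A) U^+ = T^+ and
   U^+ V = (1 + A)^-1 A. For A positive semidefinite, the eigenvalues of U^+ V
   are thus the a / (1 + a) for a an eigenvalue of A, and
   rho(U^+ V) = b / (1 + b) < 1 with b the largest eigenvalue of A. By the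
   Rayleigh bound b increases with A in the Loewner order, and so does
   b / (1 + b). *)

Require Import Defs.
From mathcomp Require Import sesquilinear spectral.

Local Open Scope ring_scope.
Local Open Scope classical_set_scope.
Local Open Scope sesquilinear_scope.

Import Order.TTheory GRing.Theory Num.Theory.

Section NumClosedTheory.
Set Implicit Arguments.
Unset Strict Implicit.
Variable C : numClosedFieldType.

(** * Projectors of a proper splitting and the iteration identity *)

Lemma mx_eq_col m n (A B : 'M[C]_(m, n)) :
  (forall x : 'cV[C]_n, A *m x = B *m x) -> A = B.
Proof.
move=> AB; apply/matrixP => i j.
by have /matrixP/(_ i 0) := AB (delta_mx j 0); rewrite -!colE !mxE.
Qed.

Lemma mul_pinv_of_range m n (T U : 'M[C]_(m, n)) :
  range_mx U `<=` range_mx T -> T *m mpinvmx T *m U = U.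
Proof.
move=> UT; apply: mx_eq_col => x.
have [y _ Ty] : range_mx T (U *m x) by apply: UT; exists x.
by have [TXT _ _ _] := mpinvmxP T; rewrite -mulmxA -Ty mulmxA TXT.
Qed.

(** Each [x - T^+ T x] lies in the nullspace of [T], hence is killed by [U]. *)
Lemma mul_pinv_of_null m n (T U : 'M[C]_(m, n)) :
  null_mx T `<=` null_mx U -> U *m (mpinvmx T *m T) = U.
Proof.
move=> TU; have [TXT _ _ _] := mpinvmxP T.
apply: mx_eq_col => x; apply/esym/eqP; rewrite -subr_eq0 -mulmxA -mulmxBr.
by apply/eqP/TU; rewrite /null_mx /= mulmxBr !mulmxA TXT subrr.
Qed.

(** Both products are Hermitian and each fixes the common range: the adjoint of
    [U U^+ T T^+ = T T^+] is [T T^+ U U^+ = T T^+], whose left side is also [U U^+]. *)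
Lemma range_projector m n (T U : 'M[C]_(m, n)) :
  range_mx U = range_mx T -> U *m mpinvmx U = T *m mpinvmx T.
Proof.
move=> UT; have [_ _ hU _] := mpinvmxP U; have [_ _ hT _] := mpinvmxP T.
rewrite -hT -{1}(@mul_pinv_of_range _ _ U T) ?UT//.
rewrite -mulmxA trmxC_mul hT hU mulmxA.
by rewrite mul_pinv_of_range ?UT.
Qed.

Lemma null_projector m n (T U : 'M[C]_(m, n)) :
  null_mx U = null_mx T -> mpinvmx U *m U = mpinvmx T *m T.
Proof.
move=> UT; have [_ _ _ hU] := mpinvmxP U; have [_ _ _ hT] := mpinvmxP T.
have TE : mpinvmx T *m T *m (mpinvmx U *m U) = mpinvmx T *m T.
  by rewrite -mulmxA mul_pinv_of_null ?UT.
rewrite -hT -TE trmxC_mul hT hU -mulmxA.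
by rewrite mul_pinv_of_null ?UT.
Qed.

Lemma proper_splitting_iteration m n (T U V : 'M[C]_(m, n)) :
  proper_splitting T U V ->
  (1%:M + mpinvmx T *m V) *m (mpinvmx U *m V) = mpinvmx T *m V.
Proof.
move=> [TE rUT nUT].
have VE : V = U - T by rewrite TE opprB addrC subrK.
have [_ XUX _ _] := mpinvmxP U; have [_ XTX _ _] := mpinvmxP T.
rewrite mulmxA mulmxDl mul1mx; congr (_ *m V).
(* Here [T^+ V U^+ = T^+ U U^+ - T^+ T U^+ = T^+ T T^+ - U^+ U U^+ = T^+ - U^+]. *)
rewrite {1}VE mulmxBr mulmxBl -mulmxA (range_projector rUT) mulmxA XTX.
by rewrite -(null_projector nUT) XUX addrC subrK.
Qed.

(** * Eigenvalues of positive semidefinite matrices and of the iteration matrix *)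

Lemma row_norm_gt0 n (w : 'rV[C]_n) : w != 0 -> 0 < (w *m w^t*) 0 0.
Proof. by move=> w0; rewrite -(dotmxE w w) dnorm_gt0. Qed.

Lemma psd_row_ge0 n (A : 'M[C]_n) (w : 'rV[C]_n) :
  psdmx A -> 0 <= (w *m A *m w^t*) 0 0.
Proof. by move=> [_ /(_ (w^t*))]; rewrite trmxCK. Qed.

Lemma psd_eigenvalue_ge0 n (A : 'M[C]_n) a :
  psdmx A -> eigenvalue A a -> 0 <= a.
Proof.
move=> pA /eigenvalueP[w wA w0]; have := psd_row_ge0 w pA.
by rewrite wA -scalemxAl mxE pmulr_lge0 // row_norm_gt0.
Qed.

Lemma psd_add1_unit n (A : 'M[C]_n) : psdmx A -> 1%:M + A \in unitmx.
Proof.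
move=> pA; have : ~~ eigenvalue A (-1).
  by apply/negP => /(psd_eigenvalue_ge0 pA); rewrite oppr_ge0 ler10.
rewrite negbK kermx_eq0 row_free_unit.
by rewrite (raddfN (@scalar_mx C n)) opprK addrC.
Qed.

Lemma psd_eigenvalue_add1_neq0 n (A : 'M[C]_n) a :
  psdmx A -> eigenvalue A a -> 1 + a != 0.
Proof.
by move=> pA /(psd_eigenvalue_ge0 pA) a0; rewrite gt_eqF // ltr_wpDr.
Qed.

(** Since [w (1 + A) B = w A], the substitution [v = w (1 + A)] matches row eigenvectors [w] of [A]
    with row eigenvectors [v] of [B]. *)
Lemma eigenvalue_iteration n (A B : 'M[C]_n) z :
  psdmx A -> (1%:M + A) *m B = A ->
  eigenvalue B z <-> exists2 a, eigenvalue A a & z = a / (1 + a).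
Proof.
move=> pA AB; split=> [/eigenvalueP[v vB v0]|[a ea ->]]; last first.
  have a1 := psd_eigenvalue_add1_neq0 pA ea.
  have /eigenvalueP[w wA w0] := ea.
  have wE : w *m (1%:M + A) = (1 + a) *: w.
    by rewrite mulmxDr mulmx1 wA scalerDl scale1r.
  apply/eigenvalueP; exists ((1 + a) *: w); last by rewrite scaler_eq0 negb_or a1.
  by rewrite -{1}wE -mulmxA AB wA scalerA divfK.
have uA := psd_add1_unit pA.
pose w := v *m invmx (1%:M + A).
have vw : v = w *m (1%:M + A) by rewrite /w mulmxKV.
have w0 : w != 0 by apply: contraNneq v0 => w0; rewrite vw w0 mul0mx.
have wA : (1 - z) *: (w *m A) = z *: w.
  have : w *m A = z *: (w + w *m A).
    by rewrite -{1}AB mulmxA -vw vB {1}vw mulmxDr mulmx1.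
  rewrite scalerDr scalerBl scale1r => {1}->.
  by rewrite addrK.
(* If [z = 1], then [wA] reads [0 = z *: w], which forces [z = 0]. *)
have z1 : 1 - z != 0.
  apply: contraNneq w0 => z1; move/eqP: wA;
    rewrite z1 scale0r eq_sym scaler_eq0.
  case/orP=> [/eqP z0|//]; move: z1; rewrite z0 subr0 => /eqP.
  by rewrite oner_eq0.
have ez : eigenvalue A (z / (1 - z)).
  apply/eigenvalueP; exists w => //; apply: (scalerI z1).
  by rewrite wA scalerA mulrC divfK.
exists (z / (1 - z)) => //.
have -> : 1 + z / (1 - z) = (1 - z)^-1.
  by rewrite -{1}(divff z1) -mulrDl subrK mul1r.
by rewrite invrK divfK.
Qed.

Lemma eigenvalue_le_rayleigh n (A : 'M[C]_n) a b :
  (forall w : 'rV[C]_n, (w *m A *m w^t*) 0 0 <= b * (w *m w^t*) 0 0) ->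
  eigenvalue A a -> a <= b.
Proof.
move=> Ab /eigenvalueP[w wA w0]; move: (Ab w).
by rewrite wA -scalemxAl mxE ler_pM2r // row_norm_gt0.
Qed.

(** After clearing the positive denominators, the products [a * b] cancel. *)
Lemma ler_div1D (a b : C) : 0 <= a -> a <= b -> a / (1 + a) <= b / (1 + b).
Proof.
move=> a0 ab; have b0 := le_trans a0 ab.
rewrite ler_pdivrMr ?ltr_wpDr // mulrAC ler_pdivlMr ?ltr_wpDr //.
by rewrite !mulrDr !mulr1 [b * a]mulrC lerD2r.
Qed.

(** * Rayleigh bound and spectral radius *)

Lemma hermitian_spectral_eigenvalue n (A : 'M[C]_n) i :
  A \is hermsymmx -> eigenvalue A (spectral_diag A 0 i).
Proof.
move=> /hermitian_normalmx /orthomx_spectralP AE.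
have uP := spectral_unit A.
apply/eigenvalueP; exists (row i (spectralmx A)).
  rewrite {2}AE -row_mul !mulmxA mulmxV // mul1mx.
  by apply/rowP => j; rewrite !mul_diag_mx !mxE.
rewrite rowE mulmx_free_eq0 ?row_free_unit //.
by apply/rV0Pn; exists i; rewrite mxE !eqxx oner_eq0.
Qed.

Lemma hermitian_rayleigh_le n (A : 'M[C]_n) b (w : 'rV[C]_n) :
  A \is hermsymmx -> (forall i, spectral_diag A 0 i <= b) ->
  (w *m A *m w^t*) 0 0 <= b * (w *m w^t*) 0 0.
Proof.
move=> /hermitian_normalmx /orthomx_spectralP AE le_b.
have uP := spectral_unitarymx A.
(* In these unitary coordinates the form is the sum of [d_i |y_i|^2], with [d] the spectral
   diagonal, and the norm is preserved. *)
pose y := w *m (spectralmx A)^t*.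
have wE : w = y *m spectralmx A.
  by rewrite /y -invmx_unitary // mulmxKV // spectral_unit.
have -> : w *m A *m w^t* = y *m diag_mx (spectral_diag A) *m y^t*.
  by rewrite {1}AE invmx_unitary // !mulmxA /y trmxC_mul trmxCK !mulmxA.
have -> : w *m w^t* = y *m y^t*.
  by rewrite {1}wE /y trmxC_mul trmxCK mulmxA.
rewrite mul_mx_diag !mxE mulr_sumr; apply: ler_sum => i _; rewrite !mxE.
by rewrite mulrAC mulrC ler_wpM2r // mul_conjC_ge0.
Qed.

End NumClosedTheory.

Section Complex.
Set Implicit Arguments.
Unset Strict Implicit.
Variable R : realType.
Local Notation C := (R[i]).

Lemma hermitian_max_eigenvalue n (A : 'M[C]_n) :
  (0 < n)%N -> A \is hermsymmx ->
  exists2 b, eigenvalue A b &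
    forall w : 'rV[C]_n, (w *m A *m w^t*) 0 0 <= b * (w *m w^t*) 0 0.
Proof.
move=> n0 hA; pose d i := spectral_diag A 0 i.
have i0 : 'I_n by exact: Ordinal n0.
(* The order on [R[i]] is only partial, so the maximum is taken over real parts; it is a maximum in
   [R[i]] because the spectrum of a Hermitian matrix is real. *)
have [i _ di] := @Order.TotalTheory.arg_maxP _ _ _ i0 xpredT
  (fun i => complex.Re (d i)) isT.
exists (d i); first exact: hermitian_spectral_eigenvalue.
move=> w; apply: hermitian_rayleigh_le => // j.
have /mxOverP dR := hermitian_spectral_diag_real hA.
have Imd k : complex.Im (d k) = 0.
  by have [] := RIm_real (dR 0 k).
by rewrite lecE !Imd eqxx; exact: di.
Qed.

Lemma iteration_spectral_radius n (A B : 'M[C]_n) :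
  (0 < n)%N -> psdmx A -> (1%:M + A) *m B = A ->
  exists b, [/\ eigenvalue A b,
    forall w : 'rV[C]_n, (w *m A *m w^t*) 0 0 <= b * (w *m w^t*) 0 0 &
    spectral_radius B = complex.Re (b / (1 + b))].
Proof.
move=> n0 pA AB; have [b eb Ab] := hermitian_max_eigenvalue n0 pA.1.
have norm_div1D c : eigenvalue A c -> `|c / (1 + c)| = c / (1 + c).
  by move=> /(psd_eigenvalue_ge0 pA) c0; rewrite ger0_norm // divr_ge0 // addr_ge0.
exists b; split=> //; rewrite /spectral_radius.
set S := image _ _.
have Sb : S (complex.Re (b / (1 + b))).
  exists (b / (1 + b)); last by rewrite norm_div1D.
  by apply/(eigenvalue_iteration _ pA AB); exists b.
have ubS : ubound S (complex.Re (b / (1 + b))).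
  move=> _ [z /(eigenvalue_iteration _ pA AB)[c ec ->] <-].
  rewrite norm_div1D //.
  have := ler_div1D (psd_eigenvalue_ge0 pA ec) (eigenvalue_le_rayleigh Ab ec).
  by rewrite lecE => /andP[].
(* The upper bound [ubS] is attained by [Sb], so it is the supremum. *)
apply/eqP; rewrite eq_le ge_sup //=; last by exists (complex.Re (b / (1 + b))).
by apply: ub_le_sup => //; exists (complex.Re (b / (1 + b))).
Qed.

End Complex.

Theorem theorem6p6 (R : realType) (m n : nat)
    (T U1 V1 U2 V2 : 'M[R[i]]_(m, n)) :
  proper_splitting T U1 V1 ->
  proper_splitting T U2 V2 ->
  lowner_le 0 (mpinvmx T *m V1) ->
  lowner_le (mpinvmx T *m V1) (mpinvmx T *m V2) ->
  null_mx V1 = null_mx V2 ->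
  spectral_radius (mpinvmx U1 *m V1) <= spectral_radius (mpinvmx U2 *m V2) /\
  spectral_radius (mpinvmx U2 *m V2) < 1.
Proof.
move=> /proper_splitting_iteration AB1 /proper_splitting_iteration AB2.
move=> [_ _]; rewrite subr0 => pA1 [_ hA2 pA12] _.
have rowA12 (w : 'rV_n) : (w *m (mpinvmx T *m V1) *m w^t*) 0 0 <=
    (w *m (mpinvmx T *m V2) *m w^t*) 0 0.
  have := psd_row_ge0 w pA12.
  by rewrite mulmxBr mulmxBl [X in 0 <= X]mxE [X in _ + X]mxE subr_ge0.
have pA2 : psdmx (mpinvmx T *m V2).
  split=> // x; have := rowA12 (x^t*); rewrite trmxCK.
  by apply: le_trans; exact: pA1.2.
(* For [n = 0] there is no largest eigenvalue; both radii are the supremum of the empty set, that is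
   0. *)
have [n0|n_gt0] := posnP n.
  have sr0 (B : 'M[R[i]]_n) : spectral_radius B = 0.
    rewrite /spectral_radius (_ : image _ _ = set0) ?sup0 //.
    rewrite -subset0 => t [z /eigenvalueP[v _ v0] _]; case/negP: v0.
    by apply/eqP/rowP => -[j jn]; exfalso; rewrite n0 in jn.
  by rewrite !sr0.
have [a [ea _ ->]] := iteration_spectral_radius n_gt0 pA1 AB1.
have [b [eb Ab ->]] := iteration_spectral_radius n_gt0 pA2 AB2.
have a0 := psd_eigenvalue_ge0 pA1 ea; have b0 := psd_eigenvalue_ge0 pA2 eb.
have ab : a <= b.
  (* The Rayleigh bound [b] for the larger matrix also bounds the form of the smaller one. *)
  by apply: eigenvalue_le_rayleigh ea => w; exact: le_trans (rowA12 w) (Ab w).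
split; first by have := ler_div1D a0 ab; rewrite lecE => /andP[].
have : b / (1 + b) < 1 by rewrite ltr_pdivrMr ?mul1r ?ltrDr // ltr_wpDr.
by rewrite ltcE => /andP[].
Qed.
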